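(* Let $h(x)=\sum_{i\ge1}h_ix^i\in\mathbb{K}[[x]]$ with $h_i\ne0$ for all $i\ge1$. Let $n$ be a positive integer, $y_0,y_1,\dots,y_{n-1}\in\mathbb{K}$, and let $G:\mathbb{K}[[x]]\to\mathbb{K}[[x]]$ satisfy $d(G(f),G(g))\le 2^{n-1}d(f,g)$ for all $f,g$. Then the initial value problem $$\mathcal{D}_h^{(n)}(y)=G(y),\quad y(0)=y_0,\ \mathcal{D}_h(y)(0)=y_1,\ \dots,\ \mathcal{D}_h^{(n-1)}(y)(0)=y_{n-1}$$ has a unique solution, which is the unique fixed point of the contractive function $$F(f)=y_0+\frac{y_1}{h_1}x+\frac{y_2}{h_2h_1}x^2+\cdots+\frac{y_{n-1}}{h_{n-1}h_{n-2}\cdots h_1}x^{n-1}+\mathcal{I}_h^{(n)}(G(f)),\qquad f\in\mathbb{K}[[x]].$$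
   Context: $\mathbb{K}$ is a field of characteristic zero. On $\mathbb{K}[[x]]$, $\omega(s)$ is the order of a series (index of its first nonzero coefficient) and $d(f,g)=2^{-\omega(f-g)}$ (with $d(f,f)=0$). The $h$-derivative is $\mathcal{D}_h\big(\sum_{k\ge0}s_kx^k\big)=\sum_{k\ge1}h_ks_kx^{k-1}$ and the $h$-integral is $\mathcal{I}_h\big(\sum_{k\ge0}s_kx^k\big)=\sum_{k\ge0}\frac{s_k}{h_{k+1}}x^{k+1}$; $\mathcal{D}_h^{(n)}$, $\mathcal{I}_h^{(n)}$ denote $n$-fold compositions. $g(0)$ denotes the constant term of $g$. A function is contractive if it is $c$-Lipschitz for $d$ with some $c\in[0,1)$. *)

(* Defs.v *)
From HB Require Import structures.
From mathcomp Require Import all_boot all_order all_algebra.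
From mathcomp Require Import all_classical all_reals.

Set Implicit Arguments.
Unset Strict Implicit.
Unset Printing Implicit Defensive.

Import Order.TTheory GRing.Theory Num.Theory.
Local Open Scope ring_scope.

(* K[[x]]: the series \sum_k s_k x^k is its coefficient sequence s, with
   coefficientwise addition. *)
Definition fps (K : fieldType) : Type := nat -> K.
HB.instance Definition _ (K : fieldType) :=
  GRing.Zmodule.copy (fps K) (nat -> K).

Section FormalPowerSeries.
Variable K : fieldType.
Implicit Types f g h s : fps K.

Definition fps_of_poly (p : {poly K}) : fps K := fun k => p`_k.

Definition const_term s : K := s 0%N.

(* The value at the zero series (whose order is infinite) is a dummy;
   [fps_dist] never uses it. *)
Definition fps_order s : nat :=
  if pselect (exists k, s k != 0) is left e then ex_minn e else 0%N.

Definition fps_dist (R : realType) f g : R :=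
  if pselect (f = g) then 0 else 2 ^- fps_order (f - g).

Definition lipschitz (R : realType) (c : R) (G : fps K -> fps K) : Prop :=
  forall f g, fps_dist R (G f) (G g) <= c * fps_dist R f g.

Definition contractive (R : realType) (G : fps K -> fps K) : Prop :=
  exists c : R, [/\ 0 <= c, c < 1 & lipschitz c G].

Definition h_derive h s : fps K := fun k => h k.+1 * s k.+1.

Definition h_integral h s : fps K :=
  fun k => if k is j.+1 then s j / h j.+1 else 0.

Definition ivp_solution h (n : nat) (y0 : 'I_n -> K) (G : fps K -> fps K)
    (y : fps K) : Prop :=
  iter n (h_derive h) y = G y /\
  forall i : 'I_n, const_term (iter i (h_derive h) y) = y0 i.

Definition initial_poly h (n : nat) (y0 : 'I_n -> K) : {poly K} :=
  \sum_(i < n) (y0 i / \prod_(1 <= j < i.+1) h j) *: 'X^i.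

Definition picard_op h (n : nat) (y0 : 'I_n -> K) (G : fps K -> fps K)
    (f : fps K) : fps K :=
  fps_of_poly (initial_poly h y0) + iter n (h_integral h) (G f).

End FormalPowerSeries.

(* Main.v *)
(** For f <> g, [d(f, g) <= 2^-m] says that f and g have the same first m
    coefficients. A [2^(n-1)]-Lipschitz map loses at most n - 1 of these common
    coefficients and the n-fold h-integral gains n of them, so F gains one: it
    is contractive, its iterates from 0 stabilise coefficientwise to a fixed
    point, and two fixed points agree to every order. Finally, a series is
    determined by its n-fold h-derivative together with its first n
    coefficients, and the comparison of y with F(y) on these data is precisely
    the initial value problem. *)
Require Import Defs.
From mathcomp Require Import all_boot all_order all_algebra.
From mathcomp Require Import all_classical all_reals.
Set Implicit Arguments.
Unset Strict Implicit.
Unset Printing Implicit Defensive.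
Import Order.TTheory GRing.Theory Num.Theory.
Local Open Scope ring_scope.

Definition fps_agree (K : fieldType) (m : nat) (f g : fps K) : Prop :=
  forall k, (k < m)%N -> f k = g k.

Section Agreement.
Variable K : fieldType.
Implicit Types f g s : fps K.

Lemma fps_eq_agree f g : (forall m, fps_agree m f g) -> f = g.
Proof. by move=> fg; apply/funext => k; apply: (fg k.+1). Qed.

Lemma fps_orderP f g : f <> g ->
  fps_agree (fps_order (f - g)) f g /\
  f (fps_order (f - g)) <> g (fps_order (f - g)).
Proof.
move=> neq_fg; rewrite /fps_order; case: pselect => [e|ne]; last first.
  (* The dummy branch of [fps_order] is impossible: if [f - g] had no nonzero coefficient, [f] and
     [g] would be equal. *)
  case: neq_fg; apply/funext => k; apply/eqP; rewrite -subr_eq0.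
  by apply/negPn/negP => nz; apply: ne; exists k.
case: ex_minnP => m nz_m min_m; split=> [k ltkm|/eqP].
  apply/eqP; rewrite -subr_eq0; apply: contraTT ltkm => nz_k.
  by rewrite -leqNgt min_m.
by rewrite -subr_eq0; apply/negP.
Qed.

Lemma fps_dist_leP (R : realType) m f g :
  fps_dist R f g <= 2 ^- m <-> fps_agree m f g.
Proof.
rewrite /fps_dist; case: pselect => [eq_fg|neq_fg] /=.
  by rewrite eq_fg; split=> // _; rewrite invr_ge0 exprn_ge0.
have [agr nagr] := fps_orderP neq_fg.
rewrite lef_pV2 ?posrE ?exprn_gt0 // ler_eXn2l ?ltr1n //.
split=> [le_m k ltkm|agr_m]; first exact: agr (leq_trans ltkm le_m).
by rewrite leqNgt; apply/negP => /agr_m.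
Qed.

(** Multiplying the bound [2 ^- (m + n)] by [2 ^+ n] leaves [2 ^- m]; from here on the argument only
    counts coefficients. *)
Lemma lipschitz_agree (R : realType) n (G : fps K -> fps K) m f g :
  lipschitz (2 ^+ n : R) G -> fps_agree (m + n) f g ->
  fps_agree m (G f) (G g).
Proof.
move=> G_lip /(fps_dist_leP R) fg; apply/(fps_dist_leP R).
apply: le_trans (G_lip f g) _; rewrite -ler_pdivlMl ?exprn_gt0 //.
by rewrite -invfM -exprD addnC.
Qed.

Section Gain.
Variable F : fps K -> fps K.
Hypothesis F_gain : forall m f g, fps_agree m f g -> fps_agree m.+1 (F f) (F g).

Lemma agree_gain_contractive (R : realType) : contractive R F.
Proof.
exists 2^-1; split=> [||f g]; rewrite ?invr_ge0 ?invf_lt1 ?ltr1n //.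
rewrite {2}/fps_dist; case: pselect => [eq_fg|neq_fg] /=.
  by rewrite mulr0 eq_fg /fps_dist; case: pselect.
(* The factor 1/2 is the gain of one coefficient over the order of [f - g]. *)
rewrite -invfM -exprS; apply/fps_dist_leP/F_gain.
by have [] := fps_orderP neq_fg.
Qed.

Lemma agree_gain_fixpoint : exists y, unique (fun f => F f = f) y.
Proof.
have iter_agree k j : fps_agree k (iter k F 0) (iter (k + j) F 0).
  by elim: k => [|k IHk] //; rewrite addSn; apply: F_gain.
(* Diagonal limit: coefficient [k] no longer changes from the iterate [k.+1] on. *)
pose y : fps K := fun k => iter k.+1 F 0 k.
have y_agree k : fps_agree k (iter k F 0) y.
  by move=> i ltik; rewrite -(subnKC ltik) -(iter_agree i.+1).
have Fy : F y = y.
  apply/funext => k; rewrite -[RHS](y_agree k.+1) //=.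
  exact/esym/(F_gain (y_agree k)).
exists y; split=> // z Fz; apply: fps_eq_agree.
by elim=> [//|m IHm]; rewrite -Fy -Fz; apply: F_gain.
Qed.

End Gain.

End Agreement.

Section HCalculus.
Variables (K : fieldType) (h : fps K).
Hypothesis h_neq0 : forall i : nat, (0 < i)%N -> h i != 0.
Implicit Types f g s t : fps K.

Lemma h_deriveK s : h_derive h (h_integral h s) = s.
Proof.
by apply/funext => k; rewrite /h_derive /= mulrCA divff ?mulr1 ?h_neq0.
Qed.

Lemma iter_h_deriveK n s : iter n (h_derive h) (iter n (h_integral h) s) = s.
Proof. by elim: n => //= n IHn; rewrite -iterS iterSr h_deriveK. Qed.

(** Each derivative shifts the index by one and contributes one factor of [h]. At [k = 0] this turns
    initial values into coefficients. *)
Lemma iter_h_deriveE n s k : iter n (h_derive h) s k =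
  \prod_(k.+1 <= j < (k + n).+1) h j * s (k + n)%N.
Proof.
elim: n k => [|n IHn] k; first by rewrite addn0 big_geq // mul1r.
rewrite iterS /h_derive IHn addSnnS mulrA [in RHS]big_ltn //.
by rewrite addnS !ltnS leq_addr.
Qed.

Lemma iter_h_deriveD n f g :
  iter n (h_derive h) (f + g) = iter n (h_derive h) f + iter n (h_derive h) g.
Proof.
by apply/funext => k; rewrite [RHS]/GRing.add /= !iter_h_deriveE -mulrDr.
Qed.

Lemma prod_h_neq0 m n : \prod_(m.+1 <= j < n) h j != 0.
Proof.
rewrite prodf_seq_neq0; apply/allP => i /=; rewrite mem_index_iota.
by case/andP => lt_mi _; apply/h_neq0/(leq_ltn_trans _ lt_mi).
Qed.

(** A coefficient of index [k >= n] is recovered from coefficient [k - n] of the derivative by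
    cancelling a nonzero product of values of [h]. *)
Lemma iter_h_derive_inj n f g :
  iter n (h_derive h) f = iter n (h_derive h) g -> fps_agree n f g -> f = g.
Proof.
move=> eqD agr; apply/funext => k; case: (ltnP k n) => [/agr //|/subnK <-].
have /eqP := congr1 (fun s : fps K => s (k - n)%N) eqD.
by rewrite !iter_h_deriveE (inj_eq (mulfI (prod_h_neq0 _ _))) => /eqP.
Qed.

Lemma iter_h_integral_agree n m s t : fps_agree m s t ->
  fps_agree (n + m) (iter n (h_integral h) s) (iter n (h_integral h) t).
Proof. by move=> agr; elim: n => //= n IHn [|k] //= /IHn ->. Qed.

Lemma iter_h_integral_eq0 n s k : (k < n)%N -> iter n (h_integral h) s k = 0.
Proof. by elim: n k => // n IHn [|k] //= /IHn ->; rewrite mul0r. Qed.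

Section InitialValueProblem.
Variables (n : nat) (y0 : 'I_n -> K) (G : fps K -> fps K).

Lemma initial_polyE (i : 'I_n) :
  (initial_poly h y0)`_i = y0 i / \prod_(1 <= j < i.+1) h j.
Proof.
rewrite coef_sum (bigD1 i) //= coefZ coefXn eqxx mulr1.
rewrite [X in _ + X]big1 ?addr0 // => j.
by rewrite coefZ coefXn eq_sym -val_eqE => /negPf ->; rewrite mulr0.
Qed.

Lemma initial_poly_eq0 k : (n <= k)%N -> (initial_poly h y0)`_k = 0.
Proof.
move=> le_nk; rewrite coef_sum big1 // => i _; rewrite coefZ coefXn.
by rewrite gtn_eqF ?mulr0 // (leq_trans _ le_nk).
Qed.

(** The n-fold integral vanishes below index [n], so these coefficients do not depend on [f]. *)
Lemma picard_op_low f (i : 'I_n) :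
  picard_op h y0 G f i = y0 i / \prod_(1 <= j < i.+1) h j.
Proof.
rewrite /picard_op [LHS]/GRing.add /= iter_h_integral_eq0 //.
by rewrite addr0 /fps_of_poly initial_polyE.
Qed.

(** The n derivatives undo the n integrals and kill the initial polynomial, which has no term of
    degree [n] or more. *)
Lemma iter_h_derive_picard_op f :
  iter n (h_derive h) (picard_op h y0 G f) = G f.
Proof.
rewrite iter_h_deriveD iter_h_deriveK -[RHS]add0r; congr (_ + _).
apply/funext => k; rewrite iter_h_deriveE /fps_of_poly.
rewrite initial_poly_eq0 ?mulr0 //.
exact: leq_addl.
Qed.

Lemma ivp_solution_fixpoint y :
  ivp_solution h y0 G y <-> picard_op h y0 G y = y.
Proof.
(* The i-th initial value of [y] is its coefficient [i] times [h 1 * ... * h i], the very product by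
   which [y0 i] is divided in [initial_poly]. *)
have init (i : 'I_n) : const_term (iter i (h_derive h) y) = y0 i <->
    picard_op h y0 G y i = y i.
  rewrite /const_term iter_h_deriveE add0n picard_op_low.
  have P0 := prod_h_neq0 0 i.+1.
  by split=> [<-|<-]; rewrite ?[_ * y i]mulrC ?mulfK // mulrC divfK.
split=> [[Dy y_init]|Fy].
  apply: (@iter_h_derive_inj n); first by rewrite iter_h_derive_picard_op.
  by move=> k ltkn; apply/(init (Ordinal ltkn)).
split=> [|i]; last by apply/init; rewrite Fy.
by rewrite -{1}Fy iter_h_derive_picard_op.
Qed.

Lemma picard_op_gain (R : realType) m f g :
  (0 < n)%N -> lipschitz (2 ^+ n.-1 : R) G -> fps_agree m f g ->
  fps_agree m.+1 (picard_op h y0 G f) (picard_op h y0 G g).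
Proof.
move=> n_gt0 G_lip agr k lekm; case: (ltnP k n) => [ltkn|lenk].
  by rewrite !(picard_op_low _ (Ordinal ltkn)).
rewrite /picard_op [LHS]/GRing.add [RHS]/GRing.add /=; congr (_ + _).
(* This makes the truncated subtraction [m.+1 - n] exact: [G] turns agreement to order
   [m = (m.+1 - n) + n.-1] into order [m.+1 - n], and the integrals raise it to [m.+1]. *)
have lenm : (n <= m.+1)%N := leq_trans lenk (ltnW lekm).
apply: (@iter_h_integral_agree n (m.+1 - n)); last by rewrite subnKC.
apply: (lipschitz_agree G_lip) => i lti; apply: agr.
by move: lti; rewrite -ltnS -addnS prednK // subnK.
Qed.

End InitialValueProblem.

End HCalculus.

Theorem mainTheorem3 (R : realType) (K : fieldType)
    (charK : [pchar K] =i pred0)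
    (h : fps K) (h0 : const_term h = 0)
    (h_neq0 : forall i : nat, (0 < i)%N -> h i != 0)
    (n : nat) (n_gt0 : (0 < n)%N) (y0 : 'I_n -> K)
    (G : fps K -> fps K) (G_lip : lipschitz (2 ^+ n.-1 : R) G) :
  contractive R (picard_op h y0 G) /\
  exists y : fps K,
    unique (ivp_solution h y0 G) y /\
    unique (fun f : fps K => picard_op h y0 G f = f) y.
Proof.
have gain m f g := @picard_op_gain K h n y0 G R m f g n_gt0 G_lip.
split; first exact: agree_gain_contractive gain R.
have [y [Fy y_uniq]] := agree_gain_fixpoint gain; exists y; split=> //.
split; first exact/ivp_solution_fixpoint.
by move=> z /(ivp_solution_fixpoint h_neq0)/y_uniq.
Qed.
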